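(* Let $z>0$ and let $(P_n)_{n\ge0}$ be the sequence of monic orthogonal polynomials with respect to the linear functional $\langle \mathbf{u}_z,p\rangle=\int_0^\infty p(x)e^{-zx^4}\,dx$, with recurrence coefficients $a_n,b_n$, and let $R_n=a_{n+1}+b_n^2+a_n$, $T_n=a_n(b_n+b_{n-1})$. For $n\ge0$ define $$\begin{aligned}C_n(x,z)=\;&4z\left[a_{n+1}(T_{n+2}+T_n)+T_{n+1}(R_{n+1}+R_n)\right]\\&+\frac{4z}{a_n}\left[a_{n+1}a_n(R_{n+1}+R_{n-1})+T_{n+1}T_n\right](x-b_n)\\&+\frac{4z}{a_{n-1}}\left[a_{n-1}T_{n+1}+a_{n+1}T_{n-1}\right]\left[(x-b_{n-1})(x-b_n)-a_n\right]\\&+4za_{n+1}\Big((x-b_{n-2})\left[(x-b_{n-1})(x-b_n)-a_n\right]-a_{n-1}(x-b_n)\Big)\end{aligned}$$ and $$\begin{aligned}D_n(x,z)=\;&-(n+1)+\frac{4z}{a_n}\left[a_{n+1}a_n(R_{n+1}+R_{n-1})+T_{n+1}T_n\right]\\&+\frac{4z}{a_{n-1}}\left[a_{n-1}T_{n+1}+a_{n+1}T_{n-1}\right](x-b_{n-1})\\&+4za_{n+1}\left[(x-b_{n-2})(x-b_{n-1})-a_{n-1}\right].\end{aligned}$$ Then $(P_n)_{n\ge0}$ satisfies $$L_nP_{n+1}(x)=P_n(x),\qquad n\ge0,$$ where $L_n=A_n(x,z)\dfrac{d}{dx}+B_n(x,z)$ and $$A_n(x,z)=\frac{x}{C_n(x,z)},\qquad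 B_n(x,z)=\frac{D_n(x,z)}{C_n(x,z)}.$$
   Context: The functional $\mathbf{u}_z$ is positive definite. The coefficients $(a_n)_{n\ge1}$, with $a_n\neq0$, and $(b_n)_{n\ge0}$ are those of the three-term recurrence relation $xP_n(x)=P_{n+1}(x)+b_nP_n(x)+a_nP_{n-1}(x)$, $n\ge0$, with $P_{-1}(x)=0$, $P_0(x)=1$.
   Formalization: For n=0,1 the formulas use a_0 and negative-index coefficients that the recurrence does not determine, and divide by a_0; here a_0=0 is assumed, quotients by zero are read as 0, and the values of a_n, b_n at negative indices are arbitrary. *)

(* Defs.v *)
From HB Require Import structures.
From mathcomp Require Import all_boot all_order all_algebra.
From mathcomp Require Import all_classical all_reals all_analysis.
Set Implicit Arguments.
Unset Strict Implicit.
Unset Printing Implicit Defensive.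
Import Order.TTheory GRing.Theory Num.Theory.
Local Open Scope classical_set_scope.
Local Open Scope ring_scope.

Definition freud_functional (R : realType) (z : R) (p : {poly R}) : R :=
  Rintegral (@lebesgue_measure R) `[0, +oo[
    (fun x => p.[x] * expR (- (z * x ^+ 4))).

Definition monic_OPS (R : realType) (u : {poly R} -> R) (P : nat -> {poly R}) :
    Prop :=
  [/\ forall n, P n \is monic,
      forall n, size (P n) = n.+1,
      forall m n, m != n -> u (P m * P n) = 0
    & forall n, u (P n * P n) != 0].

(* P_{n-1}, with P_{-1} = 0 *)
Definition prevP (R : realType) (P : nat -> {poly R}) (n : nat) : {poly R} :=
  if n is m.+1 then P m else 0.

(* The recurrence determines a_n for n >= 1 and b_n for n >= 0.  The
   coefficients C_n and D_n below mention a_{n-1} and b_{n-2} for every n >= 0,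
   so a and b are indexed by int: a_0 = 0 as usual (it multiplies P_{-1} = 0),
   while the values at negative indices are left arbitrary. *)
Definition recurrence_coefs (R : realType) (P : nat -> {poly R})
    (a b : int -> R) : Prop :=
  a 0 = 0 /\
  forall n : nat, 'X * P n = P n.+1 + b n%:Z *: P n + a n%:Z *: prevP P n.

Section Ladder.
Variables (R : realType) (z : R) (a b : int -> R).

Definition Rco (n : int) : R := a (n + 1) + b n ^+ 2 + a n.

Definition Tco (n : int) : R := a n * (b n + b (n - 1)).

(* Division by a_n (at n = 0) and by a_{n-1} (at n = 1, and possibly at n = 0)
   may be a division by 0, which has value 0 here.  The value is immaterial:
   these terms cancel in C_n P_n - D_n P_{n+1}. *)
Definition Cpoly (n : int) : {poly R} :=
  (4 * z * (a (n + 1) * (Tco (n + 2) + Tco n)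
            + Tco (n + 1) * (Rco (n + 1) + Rco n)))%:P
  + (4 * z / a n
     * (a (n + 1) * a n * (Rco (n + 1) + Rco (n - 1)) + Tco (n + 1) * Tco n))
    *: ('X - (b n)%:P)
  + (4 * z / a (n - 1)
     * (a (n - 1) * Tco (n + 1) + a (n + 1) * Tco (n - 1)))
    *: (('X - (b (n - 1))%:P) * ('X - (b n)%:P) - (a n)%:P)
  + (4 * z * a (n + 1))
    *: (('X - (b (n - 2))%:P) * (('X - (b (n - 1))%:P) * ('X - (b n)%:P) - (a n)%:P)
        - a (n - 1) *: ('X - (b n)%:P)).

Definition Dpoly (n : int) : {poly R} :=
  (- (n + 1)%:~R
   + 4 * z / a n
     * (a (n + 1) * a n * (Rco (n + 1) + Rco (n - 1)) + Tco (n + 1) * Tco n))%:P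
  + (4 * z / a (n - 1)
     * (a (n - 1) * Tco (n + 1) + a (n + 1) * Tco (n - 1)))
    *: ('X - (b (n - 1))%:P)
  + (4 * z * a (n + 1))
    *: (('X - (b (n - 2))%:P) * ('X - (b (n - 1))%:P) - (a (n - 1))%:P).

(* Rational functions of x; as _ / 0 = 0, the equation L_n P_{n+1} = P_n
   entails C_n != 0. *)
Definition Afrac (n : int) : {fraction {poly R}} :=
  tofrac 'X / tofrac (Cpoly n).

Definition Bfrac (n : int) : {fraction {poly R}} :=
  tofrac (Dpoly n) / tofrac (Cpoly n).

Definition Lop (n : int) (p : {poly R}) : {fraction {poly R}} :=
  Afrac n * tofrac p^`() + Bfrac n * tofrac p.

End Ladder.

(* Main.v *)
Require Import Defs.
From HB Require Import structures.
From mathcomp Require Import all_boot all_order all_algebra.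
From mathcomp Require Import all_classical all_reals all_analysis.
From mathcomp Require Import measurable_realfun zify ring lra.
Set Implicit Arguments.
Unset Strict Implicit.
Unset Printing Implicit Defensive.
Import Order.TTheory GRing.Theory Num.Theory.
Import numFieldNormedType.Exports.
Local Open Scope ring_scope.

(* The weight satisfies the Pearson equation (x w)' = (1 - 4 z x^4) w, so
   integration by parts gives u(p + x p') = 4 z u(x^4 p).  With
   p = P_{n+1} P_k this shows that x P_{n+1}' - (n+1) P_{n+1} equals the part of
   4 z x^4 P_{n+1} carried by P_{n-3}, ..., P_n, whose coefficients are read off
   by applying the recurrence four times.  Eliminating P_{n-1}, P_{n-2}, P_{n-3}
   with the recurrence turns this into x P_{n+1}' + D_n P_{n+1} = C_n P_n, and
   C_n is nonzero since its leading coefficient is 4 z a_{n+1}. *)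

(** * Integrals of polynomials against the quartic exponential weight on the half-line *)

Section FreudIntegral.
Variables (R : realType) (z : R).
Hypothesis z_gt0 : 0 < z.
Implicit Types p q : {poly R}.
Local Open Scope classical_set_scope.
Local Notation mu := (@lebesgue_measure R).

Definition freud_weight (x : R) : R := expR (- (z * x ^+ 4)).
Local Notation w := freud_weight.

(** On [[0, 1]] the power is at most 1. For [x > 1] it is at most [(x ^+ 4) ^+ k], a multiple of the
    degree-[k] Taylor term of the exponential. *)
Lemma exprn_le_expR_quartic (k : nat) (x : R) : 0 <= x ->
  x ^+ k <= (1 + k`!%:R / z ^+ k) * expR (z * x ^+ 4).
Proof.
move=> x_ge0; have z_ge0 := ltW z_gt0.
have y_ge0 : 0 <= z * x ^+ 4 by rewrite mulr_ge0// exprn_ge0.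
have c_ge0 : 0 <= k`!%:R / z ^+ k by rewrite divr_ge0// exprn_ge0.
have e_ge1 : 1 <= expR (z * x ^+ 4) by rewrite -expR0 ler_expR.
have [x_le1|x_gt1] := leP x 1.
  apply: (@le_trans _ _ 1); first exact: exprn_ile1.
  by rewrite -[leLHS]mulr1 ler_pM ?lerDl.
have x4k : x ^+ k <= (x ^+ 4) ^+ k.
  by rewrite -exprM; apply: ler_weXn2l; [exact: ltW|rewrite leq_pmull].
apply: (le_trans x4k); rewrite mulrDl mul1r.
have -> : (x ^+ 4) ^+ k = k`!%:R / z ^+ k * ((z * x ^+ 4) ^+ k / k`!%:R).
  have cancel (u v f : R) : u != 0 -> f != 0 -> v = f / u * (u * v / f).
    by move=> u0 f0; field; rewrite u0 f0.
  rewrite (exprMn _ z); apply: cancel; first by rewrite expf_neq0// lt0r_neq0.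
  by rewrite pnatr_eq0 -lt0n fact_gt0.
(* [expR_ge1Dxn] covers Taylor terms of positive degree only, so [k = 0] is treated apart. *)
case: k => [|k] in c_ge0 x4k *.
  by rewrite !expr0 fact0 divr1 !mul1r; lra.
apply: ler_wpDl; rewrite ?expR_ge0// ler_wpM2l//.
by apply: le_trans (expR_ge1Dxn k y_ge0); rewrite lerDr.
Qed.

Lemma horner_freud_weight_bounded p :
  exists2 c : R, 0 <= c & forall x, 0 <= x -> `|p.[x] * w x| <= c.
Proof.
exists (\sum_(i < size p) `|p`_i| * (1 + i`!%:R / z ^+ i)).
  apply: sumr_ge0 => i _; rewrite mulr_ge0// addr_ge0//.
  by rewrite divr_ge0// exprn_ge0// ltW.
move=> x x_ge0; rewrite horner_coef mulr_suml.
apply: le_trans (ler_norm_sum _ _ _) _; apply: ler_sum => i _.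
rewrite -mulrA normrM ler_wpM2l// ger0_norm ?mulr_ge0 ?exprn_ge0 ?expR_ge0//.
by rewrite /freud_weight expRN ler_pdivrMr ?expR_gt0// exprn_le_expR_quartic.
Qed.

(** Boundedness of [(1 + x^2) p w] gives a majorant with a known finite integral and an explicit
    primitive, the arctangent. *)
Lemma horner_freud_weight_le p :
  exists2 c : R, 0 <= c &
    forall x, 0 <= x -> `|p.[x] * w x| <= c * (1 + x ^+ 2)^-1.
Proof.
have [c c_ge0 cP] := horner_freud_weight_bounded (p * (1 + 'X^2)).
exists c => // x /cP; rewrite !hornerE => h.
have x2 : 0 < 1 + x ^+ 2 by rewrite ltr_wpDr ?sqr_ge0.
rewrite ler_pdivlMr// -[X in _ * X](gtr0_norm x2) -normrM.
by rewrite mulrAC.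
Qed.

Lemma continuous_freud_weight : continuous w.
Proof.
move=> x; apply: continuous_comp; last exact: continuous_expR.
apply: cvgN; apply: cvgMl_tmp; exact: exprn_continuous.
Qed.

Lemma continuous_horner_freud p : continuous (fun x => p.[x] * w x).
Proof.
by move=> x; apply: cvgM; [exact: continuous_horner|exact: continuous_freud_weight].
Qed.

Lemma integrable_inv1Dsqr (c : R) :
  mu.-integrable `[0%R, +oo[ (EFin \o (fun x : R => c * (1 + x ^+ 2)^-1)).
Proof.
rewrite (_ : _ \o _ = (fun x => c%:E * ((1 + x ^+ 2)^-1)%:E)%E)//.
apply: integrableZl => //; apply/integrableP; split.
  apply/measurable_EFinP; apply: measurable_funTS.
  by apply: continuous_measurable_fun; exact: continuous_oneDsqrV.
under eq_integral => x _ do rewrite /= ger0_norm ?invr_ge0 ?addr_ge0 ?sqr_ge0//.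
by have := integral0y_oneDsqr R; rewrite /= => ->; rewrite ltry.
Qed.

Lemma integrable_horner_freud p :
  mu.-integrable `[0%R, +oo[ (EFin \o (fun x => p.[x] * w x)).
Proof.
have [c c_ge0 cP] := horner_freud_weight_le p.
have ic := integrable_inv1Dsqr c.
apply: (le_integrable _ _ _ ic) => //=.
- apply/measurable_EFinP; apply: measurable_funTS.
  by apply: continuous_measurable_fun; exact: continuous_horner_freud.
- move=> x /=; rewrite in_itv/= andbT => x_ge0.
  by rewrite lee_fin (le_trans (cP _ x_ge0))// ler_norm.
Qed.

Lemma freud_functionalD p q :
  freud_functional z (p + q) = freud_functional z p + freud_functional z q.
Proof.
rewrite /freud_functional -RintegralD//; try exact: integrable_horner_freud.
by apply: eq_Rintegral => x _; rewrite hornerD mulrDl.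
Qed.

Lemma freud_functionalZ (c : R) p :
  freud_functional z (c *: p) = c * freud_functional z p.
Proof.
rewrite /freud_functional -RintegralZl//; last exact: integrable_horner_freud.
by apply: eq_Rintegral => x _; rewrite hornerZ -[LHS]mulrA.
Qed.

Lemma is_derive_horner_freud p (x : R) :
  is_derive x (1 : R) (fun x => p.[x] * w x)
    ((p^`() - (4 * z) *: ('X^3 * p)).[x] * w x).
Proof.
have wE : w = expR \o horner (- (z *: 'X^4)).
  by apply/funext => y; rewrite /freud_weight /= !hornerE.
have dw : is_derive x (1 : R) w (w x * (- (4 * z) * x ^+ 3)).
  rewrite [X in is_derive _ _ X]wE.
  have dh := is_derive1_comp (is_derive_expR _) (is_derive_poly (- (z *: 'X^4)) x).
  apply: (is_derive_eq dh).
  rewrite /freud_weight derivN derivZ derivXn !hornerE /=; ring.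
have dm := is_deriveM (is_derive_poly p x) dw.
apply: (is_derive_eq dm).
by rewrite !hornerE /GRing.scale /=; ring.
Qed.

Lemma cvgy_horner_freud p : p.[x] * w x @[x --> +oo] --> (0 : R).
Proof.
(* The extra factor ['X] turns the bound into [|p w| <= c / x] for [x > 0]. *)
have [c c_ge0 cP] := horner_freud_weight_le ('X * p).
have cx0 : c * x^-1 @[x --> +oo] --> (0 : R).
  rewrite -[X in _ --> X](mulr0 c); apply: cvgMl_tmp.
  by apply: (gtr0_cvgV0 _).2 => //; exact: nbhs_pinfty_gt.
apply/norm_cvg0P/(squeeze_cvgr _ (cvg_cst 0) cx0).
near=> x.
have x_gt0 : 0 < x by near: x; exact: nbhs_pinfty_gt.
rewrite normr_ge0 ler_pdivlMr//= mulrC.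
have := cP _ (ltW x_gt0); rewrite hornerM hornerX -mulrA normrM gtr0_norm//.
move=> /le_trans; apply; rewrite -[leRHS]mulr1 ler_wpM2l//.
rewrite invf_le1 ?ltr_wpDr ?sqr_ge0//.
by rewrite lerDl sqr_ge0.
Unshelve. all: by end_near. Qed.

(* The integrand changes sign, whereas the fundamental theorem at hand requires
   a nonnegative one: compare with the derivative [c / (1 + x^2)] of [c atan]. *)
Lemma freud_functional_deriv p :
  freud_functional z (p^`() - (4 * z) *: ('X^3 * p)) = - p.[0].
Proof.
set d := _ - _.
have [c c_ge0 cP] := horner_freud_weight_le d.
have dF x : is_derive x (1 : R) (fun x => c * atan x - p.[x] * w x)
    (c * (1 + x ^+ 2)^-1 - d.[x] * w x).
  exact: is_deriveB (is_deriveZ c (is_derive1_atan x)) (is_derive_horner_freud p x).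
have FTC : \int[mu]_(x in `[0%R, +oo[) (c * (1 + x ^+ 2)^-1 - d.[x] * w x)
    = c * (pi / 2) - 0 - (c * atan 0 - p.[0] * w 0).
  apply: (@Rintegral_ge0_continuous_FTC2y _ _
           (fun x => c * atan x - p.[x] * w x)).
  - by move=> x /cP h; rewrite subr_ge0 (le_trans (ler_norm _)).
  - apply: continuous_subspaceT => x; apply: cvgB; last exact: continuous_horner_freud.
    by apply: cvgMl_tmp; exact: continuous_oneDsqrV.
  - by apply: cvgB; [apply: cvgMl_tmp; exact: cvgy_atan|exact: cvgy_horner_freud].
  - by move=> x _; have [] := dF x.
  - apply: cvg_at_right_filter; apply: cvgB.
      by apply: cvgMl_tmp; exact: continuous_atan.
    exact: continuous_horner_freud.
  - by move=> x _; rewrite derive1E; have [] := dF x.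
have pi2 : \int[mu]_(x in `[0%R, +oo[) (1 + x ^+ 2)^-1 = pi / 2.
  by rewrite /Rintegral; have := integral0y_oneDsqr R; rewrite /= => ->.
rewrite RintegralB// in FTC; last 2 first.
- exact: integrable_inv1Dsqr.
- exact: integrable_horner_freud.
rewrite RintegralZl// in FTC; last first.
  by have := integrable_inv1Dsqr 1; under [X in _ \o X]funext do rewrite mul1r.
have w0 : w 0 = 1 by rewrite /freud_weight expr0n mulr0 oppr0 expR0.
(* The contributions [c * (pi / 2)] of the majorant cancel, leaving the boundary term at 0. *)
rewrite pi2 atan0 w0 in FTC.
rewrite /freud_functional; lra.
Qed.

(** Integration by parts is applied to ['X * p], whose boundary term at 0 vanishes. *)
Lemma freud_functional_Xderiv p :
  freud_functional z (p + 'X * p^`()) = 4 * z * freud_functional z ('X^4 * p).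
Proof.
have := freud_functional_deriv ('X * p).
rewrite derivM derivX mul1r mulrA -exprSr hornerM hornerX mul0r oppr0.
by rewrite -scaleNr freud_functionalD freud_functionalZ; lra.
Qed.

End FreudIntegral.

(** * Expansion of polynomials in an orthogonal sequence *)

Lemma size_X_deriv (R : nzRingType) (p : {poly R}) n :
  (size p <= n)%N -> (size ('X * p^`())%R <= n)%N.
Proof.
move=> p_le; apply/leq_sizeP => -[|j] lt_nj; rewrite coefXM//= coef_deriv.
by rewrite nth_default ?mul0rn// (leq_trans p_le).
Qed.

Section OrthogonalExpansion.
Variables (R : realType) (u : {poly R} -> R) (P : nat -> {poly R}).
Hypotheses (uD : forall p q, u (p + q) = u p + u q)
  (uZ : forall c p, u (c *: p) = c * u p) (P_OPS : monic_OPS u P).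
Implicit Types p q : {poly R}.

Let sizeP n : size (P n) = n.+1. Proof. by case: P_OPS. Qed.

Let orthP m n : m != n -> u (P m * P n) = 0.
Proof. by case: P_OPS => _ _ + _; apply. Qed.

Let u0 : u 0 = 0. Proof. by rewrite -(scale0r 0) uZ mul0r. Qed.

Let uB p q : u (p - q) = u p - u q.
Proof. by rewrite uD -scaleN1r uZ mulN1r. Qed.

Lemma OPS_neq0 n : u (P n * P n) != 0.
Proof. by case: P_OPS. Qed.

(** As [P n] is monic, the top terms cancel. This is the degree-lowering step of the two inductions
    below. *)
Lemma size_sub_lead_OPS p n : (size p <= n.+1)%N -> (size (p - p`_n *: P n)%R <= n)%N.
Proof.
case: P_OPS => monP _ _ _ p_le; apply/leq_sizeP => j.
rewrite leq_eqVlt => /predU1P[<-|lt_nj]; rewrite coefB coefZ.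
  by have /monicP := monP n; rewrite /lead_coef sizeP /= => ->; rewrite mulr1 subrr.
rewrite [p`_j]nth_default ?(leq_trans p_le)//.
by rewrite [X in _ * X]nth_default ?sizeP// mulr0 subr0.
Qed.

Lemma OPS_orthogonal_lower p n : (size p <= n)%N -> u (p * P n) = 0.
Proof.
suff H m : (m <= n)%N -> (size p <= m)%N -> u (p * P n) = 0 by exact: H.
elim: m => [|m IHm] in p *.
  by move=> _; rewrite leqn0 size_poly_eq0 => /eqP->; rewrite mul0r u0.
move=> lt_mn p_le; rewrite -(subrK (p`_m *: P m) p) mulrDl uD -scalerAl uZ.
by rewrite IHm ?size_sub_lead_OPS ?(ltnW lt_mn)// orthP ?ltn_eqF// mulr0 addr0.
Qed.

(** Pairing with the [P k] of highest degree isolates the top coefficient times a nonzero number, so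
    the coefficients vanish from the top down. *)
Lemma OPS_orthogonal_eq0 p n :
  (size p <= n)%N -> (forall k, (k < n)%N -> u (p * P k) = 0) -> p = 0.
Proof.
elim: n => [|n IHn] in p *; first by rewrite leqn0 size_poly_eq0 => /eqP.
move=> p_le orth_p; have := size_sub_lead_OPS p_le.
have pn0 : p`_n = 0.
  have := orth_p n (ltnSn n); rewrite -{1}(subrK (p`_n *: P n) p) mulrDl uD.
  rewrite OPS_orthogonal_lower ?size_sub_lead_OPS// add0r -scalerAl uZ.
  by move=> /eqP; rewrite mulf_eq0 (negPf (OPS_neq0 n)) orbF => /eqP.
rewrite pn0 scale0r subr0 => /IHn; apply => k lt_kn.
by apply: orth_p; rewrite ltnW.
Qed.

(** * The three-term recurrence, extended to integer indices and iterated *)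

Variables a b : int -> R.
Hypothesis P_rec : recurrence_coefs P a b.

(** Moving ['X] from one factor to the other gives [u (P n.+1 * P n.+1) = a n.+1 * u (P n * P n)],
    whose left side is nonzero. *)
Lemma recurrence_coef_neq0 (n : nat) : a n.+1%:Z != 0.
Proof.
case: P_rec => _ rec; apply: contraNneq (OPS_neq0 n.+1) => a0.
rewrite -{1}[P n.+1](addrK (b n%:Z *: P n + a n%:Z *: prevP P n)) addrA -rec.
rewrite mulrBl uB -mulrA mulrCA rec a0 scale0r addr0 mulrDr uD -scalerAr uZ.
rewrite mulrDl uD -!scalerAl !uZ !orthP ?mulr0 ?addr0 ?add0r ?subr0 ?ltn_eqF//.
by case: n a0 => [|n] a0 /=; rewrite ?mul0r ?u0 ?orthP ?mulr0 ?oppr0 ?ltn_eqF.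
Qed.

(** Extension by 0 lets the shifts down to [n - 3] be written uniformly for all [n >= 0]. *)
Definition intOPS (k : int) : {poly R} := if k is Posz m then P m else 0.

Lemma intOPS_rec (k : int) : 0 <= k ->
  'X * intOPS k = intOPS (k + 1) + b k *: intOPS k + a k *: intOPS (k - 1).
Proof.
case: k => // m _; case: P_rec => _ /(_ m) /= ->.
by rewrite addn1; case: m => [|m] //=; rewrite subn1.
Qed.

(* For [k = 0] the recurrence fails at [k - 1 = -1], but then [a k = 0]. *)
Lemma intOPS_rec_pred (k : int) : 0 <= k ->
  a k *: ('X * intOPS (k - 1)) =
  a k *: (intOPS k + b (k - 1) *: intOPS (k - 1) + a (k - 1) *: intOPS (k - 2)).
Proof.
case: k => [[|m]|] // _; first by case: P_rec => ->; rewrite !scale0r.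
have -> : m.+1%:Z - 2 = m%:Z - 1 by rewrite intS; ring.
have -> : m.+1%:Z - 1 = m%:Z by rewrite intS; ring.
by rewrite intOPS_rec//= addn1.
Qed.

Lemma intOPS_rec_X2 (k : int) : 0 <= k ->
  'X^2 * intOPS k = intOPS (k + 2) + (b (k + 1) + b k) *: intOPS (k + 1)
    + Rco a b k *: intOPS k + Tco a b k *: intOPS (k - 1)
    + (a k * a (k - 1)) *: intOPS (k - 2).
Proof.
move=> k_ge0; rewrite exprS expr1 -mulrA intOPS_rec// !mulrDr -!scalerAr.
have k1_ge0 : 0 <= k + 1 by rewrite addr_ge0.
rewrite intOPS_rec_pred// (intOPS_rec k_ge0) (intOPS_rec k1_ge0).
rewrite addrK -[k + 1 + 1]addrA.
rewrite /Rco /Tco -!mul_polyC !(polyCD, polyCM) /=; ring.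
Qed.

(* The [s_i] multiply polynomials orthogonal to [P_0, ..., P_n], so that their
   values are immaterial. *)
Lemma intOPS_rec_X4 (n : int) : 0 <= n ->
  exists s0 s1 s2 s3 : R,
  'X^4 * intOPS (n + 1) =
    (intOPS (n + 5) + s3 *: intOPS (n + 4) + s2 *: intOPS (n + 3)
     + s1 *: intOPS (n + 2) + s0 *: intOPS (n + 1))
  + ((a (n + 1) * (Tco a b (n + 2) + Tco a b n)
       + Tco a b (n + 1) * (Rco a b (n + 1) + Rco a b n)) *: intOPS n
     + (a (n + 1) * a n * (Rco a b (n + 1) + Rco a b (n - 1))
        + Tco a b (n + 1) * Tco a b n) *: intOPS (n - 1)
     + (a n * (a (n - 1) * Tco a b (n + 1) + a (n + 1) * Tco a b (n - 1)))
        *: intOPS (n - 2)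
     + (a (n + 1) * a n * a (n - 1) * a (n - 2)) *: intOPS (n - 3)).
Proof.
move=> n_ge0.
(* The coefficient of [intOPS (j + 1)] in ['X^2 * intOPS j]; it satisfies
   [Tco a b (j + 1) = a (j + 1) * be j]. *)
pose be j := b (j + 1) + b j.
exists (a (n + 3) * a (n + 2) + be (n + 1) * Tco a b (n + 2)
        + Rco a b (n + 1) ^+ 2 + Tco a b (n + 1) * be n + a (n + 1) * a n).
exists (Tco a b (n + 3) + be (n + 1) * Rco a b (n + 2)
        + Rco a b (n + 1) * be (n + 1) + Tco a b (n + 1)).
exists (Rco a b (n + 3) + be (n + 1) * be (n + 2) + Rco a b (n + 1)).
exists (be (n + 3) + be (n + 1)).
(* The shifted indices are free variables, so that each instance displays them in normal form. *)
have E j m1 m2 m3 m4 : 0 <= j -> j + 2 = m4 -> j + 1 = m3 -> j - 1 = m2 -> j - 2 = m1 ->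
    'X^2 * intOPS j = intOPS m4 + be j *: intOPS m3 + Rco a b j *: intOPS j
      + Tco a b j *: intOPS m2 + (a j * a m2) *: intOPS m1.
  by move=> j_ge0 <- <- <- <-; exact: intOPS_rec_X2.
have E3 := E (n + 3) (n + 1) (n + 2) (n + 4) (n + 5).
have E2 := E (n + 2) n (n + 1) (n + 3) (n + 4).
have E1 := E (n + 1) (n - 1) n (n + 2) (n + 3).
have E0 := E n (n - 2) (n - 1) (n + 1) (n + 2).
(* The factor [a n] covers [n = 0], where the index is -1 and [a 0 = 0]. *)
have Em : a n *: ('X^2 * intOPS (n - 1)) = a n *: (intOPS (n + 1)
    + be (n - 1) *: intOPS n + Rco a b (n - 1) *: intOPS (n - 1)
    + Tco a b (n - 1) *: intOPS (n - 2) + (a (n - 1) * a (n - 2)) *: intOPS (n - 3)).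
  have [->|n_neq0] := eqVneq n 0; first by case: P_rec => ->; rewrite !scale0r.
  by rewrite -E//; lia.
have -> : 'X^4 * intOPS (n + 1) = 'X^2 * ('X^2 * intOPS (n + 1)).
  by rewrite mulrA -exprD.
rewrite E1; try lia.
set rhs := RHS; rewrite !mulrDr -!scalerAr -[(a (n + 1) * a n) *: _]scalerA Em.
rewrite E3 ?E2 ?E1 ?E0; try lia.
rewrite {}/rhs.
have -> : Tco a b (n + 2) = a (n + 2) * be (n + 1).
  by rewrite /Tco /be; congr (_ * (b _ + b _)); ring.
have -> : Tco a b (n + 1) = a (n + 1) * be n by rewrite /Tco /be addrK.
have -> : Tco a b n = a n * be (n - 1) by rewrite /Tco /be subrK.
rewrite -!mul_polyC !(polyCD, polyCM) /=; ring.
Qed.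

Lemma size_intOPS (k : int) (n : nat) : k < n%:Z -> (size (intOPS k) <= n)%N.
Proof. by case: k => [m|m] /=; rewrite ?size_poly0// sizeP. Qed.

Lemma intOPS_orthogonal (j : int) (k : nat) : k%:Z < j -> u (intOPS j * P k) = 0.
Proof. by case: j => //= m lt_km; rewrite orthP// gtn_eqF. Qed.

(** * The structure relation derived from the Pearson equation *)

Variable c : R.
Hypothesis pearson : forall p, u (p + 'X * p^`()) = c * u ('X^4 * p).

Lemma OPS_structure_relation (n : nat) :
  'X * (P n.+1)^`() = n.+1%:R *: P n.+1 + c *:
    ((a (n%:Z + 1) * (Tco a b (n%:Z + 2) + Tco a b n)
       + Tco a b (n%:Z + 1) * (Rco a b (n%:Z + 1) + Rco a b n)) *: intOPS n
     + (a (n%:Z + 1) * a n * (Rco a b (n%:Z + 1) + Rco a b (n%:Z - 1))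
        + Tco a b (n%:Z + 1) * Tco a b n) *: intOPS (n%:Z - 1)
     + (a n * (a (n%:Z - 1) * Tco a b (n%:Z + 1) + a (n%:Z + 1) * Tco a b (n%:Z - 1)))
        *: intOPS (n%:Z - 2)
     + (a (n%:Z + 1) * a n * a (n%:Z - 1) * a (n%:Z - 2)) *: intOPS (n%:Z - 3)).
Proof.
have [//|s0 [s1 [s2 [s3]]]] := @intOPS_rec_X4 n%:Z.
rewrite (_ : intOPS (n%:Z + 1) = P n.+1); last by rewrite [_ + 1]addrC -intS.
(* [up] gathers the terms of index at least [n + 1], [low] those of index at most [n]. *)
set up := (X in _ = X + _); set low := (X in c *: X) => X4E0.
have {X4E0} X4E : 'X^4 * P n.+1 = up + low by exact: X4E0.
have size_low : (size low <= n.+1)%N.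
  rewrite /low.
  do ! [apply: (leq_trans (size_polyD _ _)); rewrite geq_max; apply/andP; split];
  by apply: (leq_trans (size_scale_leq _ _)); apply: size_intOPS; lia.
have up_orth k : (k <= n)%N -> u (up * P k) = 0.
  move=> le_kn; rewrite /up !mulrDl !uD -!scalerAl !uZ.
  rewrite [u (P n.+1 * P k)]orthP ?gtn_eqF//.
  by rewrite !intOPS_orthogonal ?mulr0 ?addr0//; lia.
clearbody low up.
apply/eqP; rewrite -subr_eq0; apply/eqP.
(* The difference of the two sides has degree at most [n] and pairs to 0 with [P k] for every
   [k <= n]. *)
apply: (@OPS_orthogonal_eq0 _ n.+1) => [|k]; last first.
  rewrite ltnS => le_kn; rewrite mulrBl uB mulrDl uD -!scalerAl !uZ.
  rewrite [u (P n.+1 * P k)]orthP ?gtn_eqF// mulr0 add0r.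
  have := pearson (P n.+1 * P k).
  rewrite mulrA X4E mulrDl !uD up_orth// add0r orthP ?gtn_eqF// add0r.
  rewrite derivM mulrDr uD mulrA => <-.
  rewrite [X in _ - (_ + X)](_ : _ = 0) ?addr0 ?subrr//.
  rewrite mulrCA mulrC OPS_orthogonal_lower//.
  by apply: size_X_deriv; rewrite sizeP ltnS.
rewrite opprD addrA; apply: (leq_trans (size_polyD _ _)); rewrite geq_max size_polyN.
apply/andP; split; last exact: leq_trans (size_scale_leq _ _) size_low.
apply/leq_sizeP => -[|j]// lt_nj; rewrite coefB coefZ coefXM/= coef_deriv.
(* At [j = n] the terms of degree [n + 1] cancel; beyond it both coefficients are 0. *)
have [->|ne_jn] := eqVneq j n; first by rewrite mulr_natl subrr.
by rewrite nth_default ?mul0rn ?mulr0 ?subrr// sizeP; lia.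
Qed.

End OrthogonalExpansion.

(** * Elimination of the lower polynomials and the ladder operator *)

(** The quotients [c2] and [c3] enter only through their products with [Qm1] and [Qm2], which keeps
    the identity valid when a divisor is 0. *)
Lemma ladder_combination (A : comNzRingType)
    (X b0 b1 b2 a0 a1 a2 N k c2 c3 c4 s2 s3 Q1 Q0 Qm1 Qm2 Qm3 : A) :
  X * Q0 = Q1 + b0 * Q0 + a0 * Qm1 ->
  a0 * (X * Qm1) = a0 * (Q0 + b1 * Qm1 + a1 * Qm2) ->
  a0 * a1 * (X * Qm2) = a0 * a1 * (Qm1 + b2 * Qm2 + a2 * Qm3) ->
  c2 * (a0 * Qm1) = s2 * Qm1 ->
  c3 * (a0 * a1 * Qm2) = s3 * Qm2 ->
  N * Q1 + (k * Q0 + s2 * Qm1 + s3 * Qm2 + c4 * a0 * a1 * a2 * Qm3)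
    + (- N + c2 + c3 * (X - b1) + c4 * ((X - b2) * (X - b1) - a1)) * Q1
  = (k + c2 * (X - b0) + c3 * ((X - b1) * (X - b0) - a0)
     + c4 * ((X - b2) * ((X - b1) * (X - b0) - a0) - a1 * (X - b0))) * Q0.
Proof.
move=> /eqP; rewrite -subr_eq0 => /eqP e1 /eqP; rewrite -subr_eq0 => /eqP e2.
move=> /eqP; rewrite -subr_eq0 => /eqP e3 /eqP; rewrite -subr_eq0 => /eqP e4.
move=> /eqP; rewrite -subr_eq0 => /eqP e5.
apply/esym/eqP; rewrite -subr_eq0; apply/eqP.
(* [e1], [f2] and [f3] express [a0 * Qm1], [a0 * a1 * Qm2] and [a0 * a1 * a2 * Qm3] through [Q0] and
   [Q1]. *)
have f2 := congr2 +%R (congr1 ( *%R (X - b1)) e1) e2.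
have f3 := congr2 +%R (congr1 ( *%R (X - b2)) f2)
  (congr2 +%R (congr1 ( *%R (- a1)) e1) e3).
rewrite !(mulr0, addr0) in f2 f3.
(* Each 0 is a placeholder for one relation, in the order [e1], [e4], [f2], [e5], [f3]. *)
transitivity (c2 * 0 + 0 + (c3 * 0 + 0) + c4 * 0 : A); last by rewrite !mulr0 !addr0.
rewrite -{1}e1 -{1}e4 -{1}f2 -{1}e5 -{1}f3; ring.
Qed.

Lemma Cpoly_neq0 (R : realType) (z : R) (a b : int -> R) (n : int) :
  z * a (n + 1) != 0 -> Cpoly z a b n != 0.
Proof.
move=> za_neq0; apply: contraNneq za_neq0 => C0.
(* Only the last summand of [Cpoly] reaches degree 3, with coefficient [4 * z * a (n + 1)]. *)
have : (Cpoly z a b n)`_3 = 0 by rewrite C0 coef0.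
rewrite /Cpoly -!mul_polyC !(mulrBl, mulrBr).
rewrite !(coefD, coefB, coefN, coefC, coefCM, coefMC, coefXM, coefX)/=.
rewrite !(mulr0, mul0r, mulr1, oppr0, addr0, add0r) -mulrA => /eqP.
by rewrite mulf_eq0 pnatr_eq0.
Qed.

Theorem theorem5p2 (R : realType) (z : R) (P : nat -> {poly R})
    (a b : int -> R) (z_gt0 : 0 < z)
    (P_OPS : monic_OPS (freud_functional z) P)
    (P_rec : recurrence_coefs P a b) :
  forall n : nat, Lop z a b n%:Z (P n.+1) = tofrac (P n).
Proof.
move=> n; have uD := freud_functionalD z_gt0; have uZ := freud_functionalZ z_gt0.
have a_neq0 := recurrence_coef_neq0 uD uZ P_OPS P_rec.
have C_neq0 : Cpoly z a b n%:Z != 0.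
  apply: Cpoly_neq0; rewrite [n%:Z + 1]addrC -intS.
  by rewrite mulf_neq0// lt0r_neq0.
(* Since [Cpoly] is nonzero, the claim reduces to a polynomial identity. *)
suff DC : 'X * (P n.+1)^`() + Dpoly z a b n * P n.+1 = Cpoly z a b n * P n.
  rewrite /Lop /Afrac /Bfrac ![_ / tofrac (Cpoly _ _ _ _) * _]mulrAC -mulrDl.
  by rewrite -!tofracM -tofracD DC tofracM mulrAC divff ?mul1r ?tofrac_eq0.
have n_ge0 : 0 <= n%:Z by [].
have e1 := intOPS_rec P_rec n_ge0.
have e2 := intOPS_rec_pred P_rec n_ge0.
have e3 : (a n * a (n%:Z - 1)) *: ('X * intOPS P (n%:Z - 2)) = (a n * a (n%:Z - 1)) *:
    (intOPS P (n%:Z - 1) + b (n%:Z - 2) *: intOPS P (n%:Z - 2)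
     + a (n%:Z - 2) *: intOPS P (n%:Z - 3)).
  have [->|n_gt0] := posnP n; first by case: P_rec => ->; rewrite !mul0r !scale0r.
  have n1_ge0 : 0 <= n%:Z - 1 by lia.
  have := intOPS_rec_pred P_rec n1_ge0.
  have -> : n%:Z - 1 - 1 = n%:Z - 2 by ring.
  have -> : n%:Z - 1 - 2 = n%:Z - 3 by ring.
  by rewrite -!scalerA => ->.
(* The divisor can only be 0 when the index of the polynomial is negative, and
   then the polynomial is 0. *)
have h2 (K : R) : (4 * z / a n * K) *: (a n *: intOPS P (n%:Z - 1))
    = (4 * z * K) *: intOPS P (n%:Z - 1).
  case: n {e1 e2 e3 n_ge0 C_neq0} => [|m]; first by rewrite !scaler0.
  by rewrite scalerA; congr (_ *: _); field; exact: a_neq0.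
have h3 (K : R) : (4 * z / a (n%:Z - 1) * K) *:
      ((a n * a (n%:Z - 1)) *: intOPS P (n%:Z - 2))
    = (4 * z * (a n * K)) *: intOPS P (n%:Z - 2).
  case: n {e1 e2 e3 n_ge0 h2 C_neq0} => [|[|m]]; try by rewrite !scaler0.
  rewrite scalerA; congr (_ *: _); rewrite (_ : m.+2%:Z - 1 = m.+1%:Z)//.
  by field; exact: a_neq0.
rewrite (OPS_structure_relation uD uZ P_OPS P_rec (freud_functional_Xderiv z_gt0)).
rewrite /Dpoly /Cpoly.
have Pn1 : intOPS P (n%:Z + 1) = P n.+1 by rewrite [_ + 1]addrC -intS.
have Nn : (n%:Z + 1)%:~R = n.+1%:R :> R by rewrite [_ + 1]addrC -intS.
have Pn : intOPS P n%:Z = P n by [].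
rewrite ?Pn1 Nn ?Pn in e1 e2 *.
(* With the brackets shared by [Cpoly], [Dpoly] and the structure relation made opaque, the goal
   matches [ladder_combination]. *)
set K1 := (_ + _ * (Rco _ _ _ + _)).
set K2 := (_ * (Rco _ _ _ + _) + _).
set K3 := (a (n%:Z - 1) * _ + _).
move: {h2}(h2 K2) {h3}(h3 K3).
set c2 := 4 * z / _ * K2; set c3 := 4 * z / _ * K3.
clearbody c2 c3; rewrite -?mul_polyC in e1 e2 e3 * => h2 h3.
rewrite [(a n * _)%:P]polyCM in e3 h3.
rewrite -(ladder_combination n.+1%:R%:P (4 * z * K1)%:P
  (4 * z * a (n%:Z + 1))%:P e1 e2 e3 h2 h3).
clearbody K1 K2 K3; rewrite !(polyCD, polyCN, polyCM); ring.
Qed.
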